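(* Let $A\in\mathbb{R}_{\geq 0}^{m\times n}$, $b\in\mathbb{R}_{\geq 0}^{m}$ and $c\in\mathbb{R}_{\geq 0}^{n}$, and consider the linear program $\min\{c^T x \mid Ax\geq b,\ x\geq 0\}$. Assume it has an optimal solution $x^{\mathit{OPT}}$, and write $\mathit{LIN}=c^Tx^{\mathit{OPT}}$, assumed to satisfy $\mathit{LIN}>0$. Let $\delta>0$ and let $x'$ be a feasible solution ($Ax'\geq b$, $x'\geq 0$) with $c^Tx'=(1+\delta)\mathit{LIN}$. Then for every $\alpha$ with $0<\alpha\leq \delta\,\mathit{LIN}$ there exists a feasible solution $x''$ ($Ax''\geq b$, $x''\geq 0$) with $$c^Tx''\leq (1+\delta)\mathit{LIN}-\alpha \quad\text{and}\quad \|x'-x''\|_1\leq \alpha\Big(\frac{1}{\delta}+1\Big)\frac{\|x'\|_1+\|x^{\mathit{OPT}}\|_1}{c^Tx'}.$$ Moreover, if $c=(1,1,\ldots,1)^T$, then $\|x'-x''\|_1\leq 2\alpha(1/\delta+1)$.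
   Context: $\|\cdot\|_1$ denotes the $\ell_1$-norm on $\mathbb{R}^n$. *)

(* Defs.v *)
From mathcomp Require Export all_boot all_order all_algebra.
From mathcomp Require Export reals.

Set Implicit Arguments.
Unset Strict Implicit.
Unset Printing Implicit Defensive.

Import Order.TTheory GRing.Theory Num.Theory.
Local Open Scope ring_scope.

Definition mx_le (R : realType) (m n : nat) (A B : 'M[R]_(m, n)) : Prop :=
  forall i j, A i j <= B i j.

(* c^T x, read off as the single entry of the 1 x 1 matrix c^T *m x. *)
Definition cost (R : realType) (n : nat) (c x : 'cV[R]_n) : R :=
  (c^T *m x) 0 0.

(* The norm that the libraries put on matrices is the sup norm, not this one. *)
Definition l1norm (R : realType) (n : nat) (x : 'cV[R]_n) : R :=
  \sum_(i < n) `|x i 0|.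

Definition feasible (R : realType) (m n : nat)
    (A : 'M[R]_(m, n)) (b : 'cV[R]_m) (x : 'cV[R]_n) : Prop :=
  mx_le b (A *m x) /\ mx_le 0 x.

Definition optimal (R : realType) (m n : nat)
    (A : 'M[R]_(m, n)) (b : 'cV[R]_m) (c x : 'cV[R]_n) : Prop :=
  feasible A b x /\ forall y : 'cV[R]_n, feasible A b y -> cost c x <= cost c y.

(* Main.v *)
(* Move from x' towards xOPT along the segment by the fraction
   t = alpha / (delta * LIN), which lies in ]0, 1]: feasibility is preserved by
   convexity, the cost drops by exactly alpha, and the l1 distance travelled is
   t * l1norm (x' - xOPT). *)

Require Import Defs.
From mathcomp Require Import ring lra.

Set Implicit Arguments.
Unset Strict Implicit.
Unset Printing Implicit Defensive.

Import Order.TTheory GRing.Theory Num.Theory.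
Local Open Scope ring_scope.

Lemma costD (R : realType) (n : nat) (c x y : 'cV[R]_n) :
  cost c (x + y) = cost c x + cost c y.
Proof. by rewrite /cost mulmxDr mxE. Qed.

Lemma costZ (R : realType) (n : nat) (c x : 'cV[R]_n) (a : R) :
  cost c (a *: x) = a * cost c x.
Proof. by rewrite /cost -scalemxAr mxE. Qed.

(** Nonnegative entries equal their absolute values. In the unit-cost case this turns both norms in
    the distance bound into known costs. *)
Lemma cost_const1 (R : realType) (n : nat) (x : 'cV[R]_n) :
  mx_le 0 x -> cost (const_mx 1) x = l1norm x.
Proof.
move=> x_ge0; rewrite /cost /l1norm mxE; apply: eq_bigr => i _.
by rewrite !mxE mul1r ger0_norm //; have := x_ge0 i 0; rewrite mxE.
Qed.

Lemma l1normZ (R : realType) (n : nat) (x : 'cV[R]_n) (a : R) :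
  l1norm (a *: x) = `|a| * l1norm x.
Proof.
by rewrite /l1norm mulr_sumr; apply: eq_bigr => i _; rewrite mxE normrM.
Qed.

Lemma l1norm_subr_le (R : realType) (n : nat) (x y : 'cV[R]_n) :
  l1norm (x - y) <= l1norm x + l1norm y.
Proof.
rewrite /l1norm -big_split; apply: ler_sum => i _.
by rewrite !mxE ler_normB.
Qed.

Lemma feasible_convex (R : realType) (m n : nat) (A : 'M[R]_(m, n))
    (b : 'cV[R]_m) (x y : 'cV[R]_n) (t : R) :
  0 <= t <= 1 -> feasible A b x -> feasible A b y ->
  feasible A b ((1 - t) *: x + t *: y).
Proof.
move=> /andP[t_ge0 t_le1] [Axb x_ge0] [Ayb y_ge0]; split=> i j.
  rewrite mulmxDr -!scalemxAr; move: (Axb i j) (Ayb i j).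
  (* Both products are generalized first, so that [mxE] does not unfold them into sums and [nra]
     sees their entries as atoms. *)
  by move: (A *m x) (A *m y) => u v; rewrite !mxE; nra.
have := x_ge0 i j; have := y_ge0 i j; rewrite !mxE; nra.
Qed.

Theorem theorem1 (R : realType) (m n : nat)
    (A : 'M[R]_(m, n)) (b : 'cV[R]_m) (c : 'cV[R]_n)
    (hA : mx_le 0 A) (hb : mx_le 0 b) (hc : mx_le 0 c)
    (xOPT : 'cV[R]_n) (hOPT : optimal A b c xOPT)
    (LIN : R) (hLIN : LIN = cost c xOPT) (LIN_gt0 : 0 < LIN)
    (delta : R) (delta_gt0 : 0 < delta)
    (x' : 'cV[R]_n) (hx' : feasible A b x')
    (cost_x' : cost c x' = (1 + delta) * LIN)
    (alpha : R) (alpha_gt0 : 0 < alpha) (alpha_le : alpha <= delta * LIN) :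
  exists x'' : 'cV[R]_n,
    [/\ feasible A b x'',
        cost c x'' <= (1 + delta) * LIN - alpha,
        l1norm (x' - x'') <=
          alpha * (1 / delta + 1) * ((l1norm x' + l1norm xOPT) / cost c x')
      & c = const_mx 1 -> l1norm (x' - x'') <= 2 * alpha * (1 / delta + 1)].
Proof.
have [feasOPT _] := hOPT.
have dL_gt0 : 0 < delta * LIN by rewrite mulr_gt0.
have [d_neq0 L_neq0] : delta != 0 /\ LIN != 0 by rewrite !gt_eqF.
have d1_neq0 : 1 + delta != 0 by rewrite gt_eqF // addr_gt0.
(* The denominator is the cost gap between [x'] and [xOPT], so [t <= 1] is exactly [alpha_le]. *)
pose t := alpha / (delta * LIN).
have t_ge0 : 0 <= t by rewrite divr_ge0 // ltW.
have t01 : 0 <= t <= 1 by rewrite t_ge0 /= ler_pdivrMr // mul1r.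
(* The right-hand side is [t * cost c x'], which is why dividing by [cost c x'] in the third claim
   leaves just [t] times the sum of the norms. *)
have tE : alpha * (1 / delta + 1) = t * ((1 + delta) * LIN).
  by rewrite /t; field; rewrite d_neq0 L_neq0.
have dist_le : l1norm (x' - ((1 - t) *: x' + t *: xOPT)) <=
    t * (l1norm x' + l1norm xOPT).
  have -> : x' - ((1 - t) *: x' + t *: xOPT) = t *: (x' - xOPT).
    by apply/matrixP => i j; rewrite !mxE; ring.
  by rewrite l1normZ ger0_norm // ler_wpM2l // l1norm_subr_le.
exists ((1 - t) *: x' + t *: xOPT); split.
- exact: feasible_convex.
- rewrite costD !costZ cost_x' -hLIN le_eqVlt; apply: predU1l.
  by rewrite /t; field; rewrite d_neq0 L_neq0.
- apply: le_trans dist_le _; rewrite tE cost_x' le_eqVlt; apply: predU1l; field.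
  by rewrite d1_neq0 L_neq0.
- move=> c1; apply: le_trans dist_le _.
  have [[_ x'_ge0] [_ xOPT_ge0]] := (hx', feasOPT).
  (* The norms become [(1 + delta) * LIN] and [LIN]; after cancelling [t], it remains that the
     second is at most the first. *)
  rewrite -!cost_const1 // -c1 cost_x' -hLIN -mulrA tE.
  rewrite [leRHS]mulrCA ler_wpM2l //; nra.
Qed.
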